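(* For all integers $v\ge4$ and $d\ge1$, \[\sum_{D\in\mathcal{D}_{v,d}(132)} w^{rlmax(\pi_D)}x^{des(\pi_D)}y^{d}z^{lis(\pi_D)} = \sum_{p\in Dyck_{v,d}} w^{touchpoints(p)}x^{corners(p)}y^{d}z^{height(p)}.\]
   Context: A diamond with $v$ vertices ($v\ge4$) is the poset with a least element, a greatest element, and $v-2$ pairwise incomparable middle elements (in a fixed left-to-right order) strictly between them. $\mathcal{D}_{v,d}$ is the set of labellings of $d$ diamonds (placed left to right) by $1,\dots,vd$, each label used once, such that in each diamond least label $<$ each middle label $<$ greatest label. For $D\in\mathcal{D}_{v,d}$, $\pi_D$ is the permutation obtained by reading the diamonds left to right and, within each diamond, the least element, then the middle elements left to right, then the greatest element. $\mathcal{D}_{v,d}(132)$ is the set of $D$ with $\pi_D$ avoiding the classical pattern $132$. For a permutation $\pi$: $des(\pi)$ is the number of $i$ with $\pi_i>\pi_{i+1}$; $lis(\pi)$ is the length of a longest increasing subsequence; $rlmax(\pi)$ is the number of right-to-left maxima (entries larger than all entries to their right). $Dyck_{v,d}$ is the set of lattice paths from $(0,0)$ to $(d,vd)$ with steps $(1,0)$ (East) and $(0,1)$ (North) staying weakly below the line $y=vx$. For $p\in Dyck_{v,d}$: $touchpoints(p)$ is the number of points of $p$ lying on the line $y=vx$, excluding the endpoint $(d,vd)$; $corners(p)$ is the number of North steps of $p$ immediately followed by an East step; $height(p)$ is the greatest vertical distance from a point of $p$ to the line $y=vx$, i.e. the maximum of $vx-y$ over points $(x,y)$ of $p$. *)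

(* Defs.v *)
From mathcomp Require Import all_boot all_order all_algebra.
From mathcomp.multinomials Require Import mpoly.

Set Implicit Arguments.
Unset Strict Implicit.
Unset Printing Implicit Defensive.

Import GRing.Theory.

(* Permutations are represented by their one-line notation, a word over nat. *)

Definition avoids132 (s : seq nat) : bool :=
  ~~ [exists i : 'I_(size s), exists j : 'I_(size s), exists k : 'I_(size s),
        [&& i < j, j < k, nth 0 s i < nth 0 s k & nth 0 s k < nth 0 s j]].

Definition des (s : seq nat) : nat :=
  #|[set i : 'I_(size s).-1 | nth 0 s i.+1 < nth 0 s i]|.

(* The subsequences of s are the words [mask m s], m a bit mask. *)
Definition lis (s : seq nat) : nat :=
  \max_(m : (size s).-tuple bool | sorted ltn (mask m s)) size (mask m s).

Definition rlmax (s : seq nat) : nat :=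
  #|[set i : 'I_(size s) |
      [forall j : 'I_(size s), (i < j) ==> (nth 0 s j < nth 0 s i)]]|.

(* The diamond with v vertices lives on 'I_v: 0 is the least element, v.-1 the
   greatest one, and 1, ..., v.-2 are the middle elements from left to right. *)
Definition diamond_lt (v : nat) (a b : 'I_v) : bool :=
  (a < b) && ((a == 0 :> nat) || (b == v.-1 :> nat)).

(* D (i, a) is the label of vertex a of the i-th diamond; the element k of
   'I_(v * d) stands for the label k.+1, so that the labels are 1, ..., v * d.
   Injectivity is bijectivity here, as both sides have cardinal v * d. *)
Notation labelling v d := {ffun 'I_d * 'I_v -> 'I_(v * d)}.

Definition label (v d : nat) (D : labelling v d) (i : 'I_d) (a : 'I_v) : nat :=
  (D (i, a)).+1.

Definition diamonds (v d : nat) : {set labelling v d} :=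
  [set D : labelling v d | injectiveb D &
     [forall i : 'I_d, forall a : 'I_v, forall b : 'I_v,
        diamond_lt a b ==> (label D i a < label D i b)]].

Definition diamond_perm (v d : nat) (D : labelling v d) : seq nat :=
  [seq label D i a | i <- enum 'I_d, a <- enum 'I_v].

Definition diamonds132 (v d : nat) : {set labelling v d} :=
  [set D in diamonds v d | avoids132 (diamond_perm D)].

Lemma perm_diamond_perm (v d : nat) (D : labelling v d) :
  D \in diamonds v d -> perm_eq (diamond_perm D) (iota 1 (v * d)).
Proof.
rewrite inE => /andP[/injectiveP injD _].
have usz : uniq (diamond_perm D).
  apply: allpairs_uniq; [exact: enum_uniq | exact: enum_uniq |].
  by move=> [i a] [j b] _ _ /= [] /val_inj /injD.
have szE : size (diamond_perm D) = v * d.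
  by rewrite size_allpairs -!cardE !card_ord mulnC.
apply: uniq_perm => //; first exact: iota_uniq.
have sub : {subset diamond_perm D <= iota 1 (v * d)}.
  move=> n /allpairsP[[i a] [_ _ ->]].
  by rewrite mem_iota /label /= add1n ltnS ltn_ord.
by have [] := uniq_min_size usz sub; rewrite ?size_iota ?szE.
Qed.

(* Lattice paths are words in the steps East = (1,0) and North = (0,1). *)
Notation step := bool (only parsing).
Definition East : step := false.
Definition North : step := true.

Definition points (p : seq step) : seq (nat * nat) :=
  [seq (count_mem East (take k p), count_mem North (take k p))
     | k <- iota 0 (size p).+1].

Definition Dyck (v d : nat) : {set (d + v * d).-tuple step} :=
  [set p : (d + v * d).-tuple step |
     (last (0, 0) (points p) == (d, v * d)) &&
     all (fun q : nat * nat => q.2 <= v * q.1) (points p)].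

(* The points of a path are pairwise distinct, so [count] counts points. *)
Definition touchpoints (v d : nat) (p : seq step) : nat :=
  count (fun q : nat * nat => (q.2 == v * q.1) && (q != (d, v * d))) (points p).

Definition corners (p : seq step) : nat :=
  #|[set k : 'I_(size p).-1 |
      (nth East p k == North) && (nth East p k.+1 == East)]|.

(* The truncated subtraction is exact on Dyck paths, where q.2 <= v * q.1. *)
Definition height (v : nat) (p : seq step) : nat :=
  \max_(q <- points p) (v * q.1 - q.2).

Definition var_w : {mpoly int[4]} := 'X_(@Ordinal 4 0 isT).
Definition var_x : {mpoly int[4]} := 'X_(@Ordinal 4 1 isT).
Definition var_y : {mpoly int[4]} := 'X_(@Ordinal 4 2 isT).
Definition var_z : {mpoly int[4]} := 'X_(@Ordinal 4 3 isT).

(* Main.v *)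
Require Import Defs.
From mathcomp Require Import all_boot all_order all_algebra.
From mathcomp.multinomials Require Import mpoly.
From mathcomp Require Import zify.

(* Avoiding 132 forces the labels of each diamond to increase, since the least
   label followed by a descent among the middle ones is an occurrence of 132.
   It also makes the values of the first diamond consecutive, say m.+1, ...,
   m + v, and forces the k larger values, which all lie to the right, to
   increase.  Recording k for each diamond encodes the permutation as a word
   k_1 ... k_d with k_d = 0 and k_i <= v + k_(i+1).
   Read from right to left, v + k_i is the vertical distance to the line
   y = v * x right after the corresponding East step of a path, so such words
   encode the Dyck paths as well.  In terms of the word, both rlmax and
   touchpoints count the zeros, both des and corners count the i < d with
   k_i < v + k_(i+1), and both lis and height are the maximum of v + k_i. *)

(** * Codes, their lattice paths, and the decoding of a path *)

(* An upper bound for the next letter put in front of the code c: the number of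
   entries of [perm_of v c] that are at least its first entry, and the length of
   the final run of North steps of [path_of v c]. *)
Definition room (v : nat) (c : seq nat) : nat :=
  if c is k :: _ then v + k else 0.

Fixpoint valid (v : nat) (c : seq nat) : bool :=
  if c is k :: c' then (k <= room v c') && valid v c' else true.

(** The path is built from the end of the code and stops right after an East step, at distance
    [room v c] from the line. The North run lowers the distance from [room v c'] to [k], and the
    East step raises it to [v + k]. *)
Fixpoint prefix_of (v : nat) (c : seq nat) : seq bool :=
  if c is k :: c' then
    rcons (prefix_of v c' ++ nseq (room v c' - k) North) East
  else [::].

Definition path_of (v : nat) (c : seq nat) : seq bool :=
  prefix_of v c ++ nseq (room v c) North.

(* The state (c, j) stands for the path [prefix_of v c ++ nseq j North]. *)
Definition decode_step (v : nat) (cj : seq nat * nat) (s : bool) :=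
  if s == North then (cj.1, cj.2.+1) else (room v cj.1 - cj.2 :: cj.1, 0).

Definition decode (v : nat) (p : seq bool) : seq nat * nat :=
  foldl (decode_step v) ([::], 0) p.

Definition code_of (v : nat) (p : seq bool) : seq nat := (decode v p).1.

(** Each letter raises [room] by at most [v]. This makes the truncated subtractions from
    [v * size c] exact. *)
Lemma room_le v c : valid v c -> room v c <= v * size c.
Proof. by elim: c => //= k c IH /andP[kc /IH]; lia. Qed.

Lemma decode_rcons v p s : decode v (rcons p s) = decode_step v (decode v p) s.
Proof. by rewrite /decode foldl_rcons. Qed.

Lemma rcons_nseqS p j :
  p ++ nseq j.+1 North = rcons (p ++ nseq j North) North.
Proof.
by rewrite rcons_cat -cats1 -[X in _ ++ (_ ++ X)]/(nseq 1 North) -nseqD addn1.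
Qed.

Lemma decode_cat_nseq v p j :
  decode v (p ++ nseq j North) = ((decode v p).1, (decode v p).2 + j).
Proof.
elim: j => [|j IH]; first by rewrite cats0 addn0; case: (decode v p).
by rewrite rcons_nseqS decode_rcons IH /decode_step /= addnS.
Qed.

Lemma decode_prefix_of v c : valid v c -> decode v (prefix_of v c) = (c, 0).
Proof.
elim: c => //= k c IH /andP[kc /IH dc].
by rewrite decode_rcons decode_cat_nseq dc /decode_step /= add0n subKn.
Qed.

Lemma code_of_path_of v c : valid v c -> code_of v (path_of v c) = c.
Proof.
by move=> vc; rewrite /code_of /path_of decode_cat_nseq decode_prefix_of.
Qed.

(** * Points of a path and the bijection between codes and Dyck paths *)

Definition point (p : seq bool) : nat * nat := (count_mem East p, count_mem North p).
Arguments point : simpl never.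

Lemma points_rcons p s : points (rcons p s) = rcons (points p) (point (rcons p s)).
Proof.
rewrite /points size_rcons -(addn1 (size p).+1) iotaD map_cat -[RHS]cats1.
congr (_ ++ _).
  apply/eq_in_map => k; rewrite mem_iota => kp.
  rewrite -cats1 take_cat; case: ltnP => // pk.
  by rewrite (_ : k = size p) ?subnn ?take_size ?cats0 //; lia.
by rewrite /= add0n take_oversize ?size_rcons.
Qed.

Lemma points_nil : points [::] = [:: (0, 0)]. Proof. by []. Qed.

Lemma last_points p : last (0, 0) (points p) = point p.
Proof. by case/lastP: p => // p s; rewrite points_rcons last_rcons. Qed.

Lemma point_cat_nseq p j :
  point (p ++ nseq j North) = ((point p).1, (point p).2 + j).
Proof. by rewrite /point !count_cat !count_nseq /=; congr pair; lia. Qed.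

Lemma point_rcons_East p : point (rcons p East) = ((point p).1.+1, (point p).2).
Proof. by rewrite /point -cats1 !count_cat /=; congr pair; lia. Qed.

Lemma point_prefix_of v c :
  valid v c -> point (prefix_of v c) = (size c, v * size c - room v c).
Proof.
elim: c => [|k c IH] /=; first by rewrite muln0.
case/andP=> kc vc; rewrite point_rcons_East point_cat_nseq (IH vc) /=.
by congr pair; have := room_le _ _ vc; lia.
Qed.

Lemma point_path_of v c :
  valid v c -> point (path_of v c) = (size c, v * size c).
Proof.
move=> vc; rewrite point_cat_nseq point_prefix_of //=.
by rewrite subnK ?room_le.
Qed.

Lemma size_point p : size p = (point p).1 + (point p).2.
Proof.
rewrite /point /= -(count_predC (pred1 East) p); congr (_ + _).
by apply: eq_count => -[].
Qed.

Definition below (v : nat) (p : seq bool) : bool :=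
  all (fun q : nat * nat => q.2 <= v * q.1) (points p).

Lemma below_rcons v p s :
  below v (rcons p s) =
  below v p && ((point (rcons p s)).2 <= v * (point (rcons p s)).1).
Proof. by rewrite /below points_rcons all_rcons andbC. Qed.

Lemma below_cat_nseq v p j : below v p -> (point p).2 + j <= v * (point p).1 ->
  below v (p ++ nseq j North).
Proof.
move=> bp; elim: j => [|j IH] jp; first by rewrite cats0.
rewrite rcons_nseqS below_rcons IH; last lia.
by rewrite -rcons_nseqS point_cat_nseq.
Qed.

Lemma below_prefix_of v c : valid v c -> below v (prefix_of v c).
Proof.
elim: c => //= k c IH /andP[kc vc]; have rc := room_le _ _ vc.
rewrite below_rcons below_cat_nseq ?IH ?point_rcons_East ?point_cat_nseq
  ?point_prefix_of //=; lia.
Qed.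

Lemma below_path_of v c : valid v c -> below v (path_of v c).
Proof.
move=> vc; rewrite below_cat_nseq ?below_prefix_of ?point_prefix_of //=.
by rewrite subnK ?room_le.
Qed.

(** Invariant of the decoder, by induction on the last step. Staying below the line keeps the
    current run [j] within [room v c], so the letter [room v c - j] recorded at an East step gives
    back exactly [j] North steps. *)
Lemma decode_spec v p : below v p ->
  let: (c, j) := decode v p in
  [/\ valid v c, j <= room v c & p = prefix_of v c ++ nseq j North].
Proof.
elim/last_ind: p => //= p s IH; rewrite below_rcons => /andP[/IH].
rewrite decode_rcons; case: (decode v p) => c j [vc jc ->].
have rc := room_le _ _ vc.
case: s; rewrite -?[true]/North -?[false]/East.
  rewrite -rcons_nseqS point_cat_nseq point_prefix_of //= => jr.
  by split=> //; lia.
by move=> _; rewrite /decode_step /= leq_subr cats0 subKn.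
Qed.

(** Ending on the line forces the last North run to have length [room v c]. *)
Lemma path_of_code_of v d p : below v p -> point p = (d, v * d) ->
  [/\ valid v (code_of v p), size (code_of v p) = d
    & path_of v (code_of v p) = p].
Proof.
move=> /decode_spec; rewrite /code_of; case: (decode v p) => c j /= [vc jc ->].
rewrite point_cat_nseq point_prefix_of //= => -[<- jE].
by split=> //; rewrite /path_of (_ : room v c = j) //; have := room_le _ _ vc; lia.
Qed.

Lemma DyckP v d (p : (d + v * d).-tuple bool) :
  p \in Dyck v d = below v p && (point p == (d, v * d)).
Proof. by rewrite inE last_points andbC. Qed.

(** * Corners of the path of a code *)

Fixpoint ndrops (v : nat) (c : seq nat) : nat :=
  if c is k :: c' then (k < room v c') + ndrops v c' else 0.

(** A common recursive form of [corners] and [des], which both count adjacent pairs. *)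
Fixpoint nadj {T : Type} (r : rel T) (s : seq T) : nat :=
  if s is x :: s' then (if s' is y :: _ then r x y : nat else 0) + nadj r s' else 0.

Lemma card_adj {T : Type} (r : rel T) x0 s :
  #|[set i : 'I_(size s).-1 | r (nth x0 s i) (nth x0 s i.+1)]| = nadj r s.
Proof.
rewrite cardsE -sum1_card big_mkcond /=.
case: s => [|x s]; first by rewrite big_ord0.
elim: s x => [|y s IH] x; first by rewrite big_ord0.
rewrite -[RHS]/((r x y : nat) + nadj r (y :: s)) -IH big_ord_recl /=.
by congr addn; case: (r x y).
Qed.

Lemma nadj_cat {T : Type} (r : rel T) x s y t :
  nadj r ((x :: s) ++ y :: t) = nadj r (x :: s) + r (last x s) y + nadj r (y :: t).
Proof.
elim: s x => [|z s IH] x //.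
rewrite -[LHS]/((r x z : nat) + nadj r ((z :: s) ++ y :: t)) IH.
by rewrite -[nadj r (x :: _)]/((r x z : nat) + nadj r (z :: s)) !addnA.
Qed.

Definition corner : rel bool := fun a b => (a == North) && (b == East).

Lemma nadj_corner_rcons p a :
  nadj corner (rcons p a) = nadj corner p + corner (last East p) a.
Proof.
by case: p => [|b p]; rewrite -?cats1 ?nadj_cat //= !addn0.
Qed.

Lemma nadj_corner_nseq p j : nadj corner (p ++ nseq j North) = nadj corner p.
Proof.
elim: j => [|j IH]; first by rewrite cats0.
by rewrite rcons_nseqS nadj_corner_rcons IH /corner andbF addn0.
Qed.

Lemma last_prefix_of v c : last East (prefix_of v c) = East.
Proof. by case: c => //= k c; rewrite last_rcons. Qed.

(** The East step of [k] closes a corner exactly when the North run before it is nonempty. After an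
    empty run it follows an East step or starts the path, and the default [East] of [last] covers
    the latter case. *)
Lemma nadj_prefix_of v c : nadj corner (prefix_of v c) = ndrops v c.
Proof.
elim: c => //= k c IH; rewrite nadj_corner_rcons nadj_corner_nseq IH addnC.
congr addn; rewrite -subn_gt0 last_cat last_prefix_of.
case: (_ - k) => // j; rewrite -[nseq _ _]cat0s rcons_nseqS last_rcons.
by [].
Qed.

Lemma corners_path_of v c : corners (path_of v c) = ndrops v c.
Proof.
by rewrite /corners (card_adj corner) nadj_corner_nseq nadj_prefix_of.
Qed.

(** * Height of the path of a code *)

Lemma height_rcons v p s :
  height v (rcons p s) =
  maxn (height v p) (v * (point (rcons p s)).1 - (point (rcons p s)).2).
Proof. by rewrite /height points_rcons -cats1 big_cat big_seq1. Qed.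

Lemma height_ge v p : v * (point p).1 - (point p).2 <= height v p.
Proof.
case/lastP: p => [|p s]; first by rewrite muln0.
by rewrite height_rcons leq_maxr.
Qed.

Lemma height_cat_nseq v p j : height v (p ++ nseq j North) = height v p.
Proof.
elim: j => [|j IH]; first by rewrite cats0.
rewrite rcons_nseqS height_rcons IH -rcons_nseqS point_cat_nseq /=.
apply/maxn_idPl; apply: leq_trans (height_ge v p).
by rewrite leq_sub2l ?leq_addr.
Qed.

(** North steps only decrease the distance to the line, so the maximum is reached right after an
    East step, where the distance is [v + k]. *)
Lemma height_path_of v c :
  valid v c -> height v (path_of v c) = \max_(k <- c) (v + k).
Proof.
rewrite height_cat_nseq; elim: c => [|k c IH] /=.
  by rewrite /height points_nil big_seq1 big_nil muln0.
case/andP=> kc vc; rewrite height_rcons height_cat_nseq IH // big_cons maxnC.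
congr maxn; rewrite point_rcons_East point_cat_nseq point_prefix_of //=.
by have := room_le _ _ vc; lia.
Qed.

(** * Touchpoints of the path of a code *)

Definition on_line (v : nat) (q : nat * nat) : bool := q.2 == v * q.1.

Lemma count_on_line_rcons v p s :
  count (on_line v) (points (rcons p s)) =
  count (on_line v) (points p) + on_line v (point (rcons p s)).
Proof. by rewrite points_rcons -cats1 count_cat /= addn0. Qed.

(** Under the bound, a North run can meet the line only at its last point; for [j = 0] that point is
    already counted. *)
Lemma count_on_line_cat_nseq v p j : (point p).2 + j <= v * (point p).1 ->
  count (on_line v) (points (p ++ nseq j North)) =
  count (on_line v) (points p) + ((0 < j) && ((point p).2 + j == v * (point p).1)).
Proof.
elim: j => [|j IH] jp; first by rewrite cats0 ltnn andFb addn0.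
rewrite rcons_nseqS count_on_line_rcons IH ?(leq_trans _ jp) //; last first.
  by rewrite leq_add2l.
rewrite (_ : (_ + j == _) = false) ?andbF ?addn0; last by lia.
by rewrite -rcons_nseqS point_cat_nseq.
Qed.

(** The East step ends strictly below the line, so a new point on the line can only be the end of a
    nonempty North run, at distance [k]. *)
Lemma count_on_line_prefix_cons v k c : 0 < v -> valid v (k :: c) ->
  count (on_line v) (points (prefix_of v (k :: c))) =
  count (on_line v) (points (prefix_of v c)) + ((k == 0) && (k < room v c)).
Proof.
move=> v0 /andP[kc vc]; have rc := room_le _ _ vc.
rewrite [prefix_of v (k :: c)]/= count_on_line_rcons point_rcons_East point_cat_nseq.
rewrite count_on_line_cat_nseq !point_prefix_of // ?[fst _]/= ?[snd _]/=; last first.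
  by rewrite /=; lia.
rewrite -addnA; congr addn; rewrite subn_gt0 [on_line _ _]ltn_eqF ?addn0 /=; last lia.
by congr nat_of_bool; apply/idP/idP; lia.
Qed.

(** The origin accounts for the last letter, a zero with an empty North run. Any other zero has a
    nonempty run, because [room] is at least [v] on a nonempty code. *)
Lemma count_on_line_prefix_of v k c : 0 < v -> valid v (k :: c) ->
  count (on_line v) (points (prefix_of v (k :: c))) = count_mem 0 (k :: c).
Proof.
move=> v0; elim: c k => [|l c IH] k vkc; have [kc vc] := andP vkc.
  move: kc vkc; rewrite leqn0 => /eqP-> vkc; rewrite count_on_line_prefix_cons //.
  by rewrite points_nil /= /on_line /= muln0.
rewrite count_on_line_prefix_cons // IH // addnC; congr addn.
by case: k {vkc kc}; rewrite ?ltn_addr.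
Qed.

Lemma touchpoints_rcons v d p s : point (rcons p s) = (d, v * d) ->
  touchpoints v d (rcons p s) = count (on_line v) (points p).
Proof.
move=> pE; rewrite /touchpoints points_rcons -cats1 count_cat pE.
rewrite [X in _ + X]/= !eqxx !addn0.
apply: eq_in_count => q /mapP[k]; rewrite mem_iota => kp ->; rewrite /on_line.
(* The coordinates of a point add up to the number of steps taken, so the endpoint is not reached
   before the last step. *)
case: eqVneq => //= _; apply/eqP => -[kE kN].
have := size_point (rcons p s); rewrite pE size_rcons /=.
have := size_point (take k p); rewrite size_take_min /point /= kE kN; lia.
Qed.

Lemma touchpoints_path_of v c : 0 < v -> valid v c ->
  touchpoints v (size c) (path_of v c) = count_mem 0 c.
Proof.
case: c => [|k c] v0 vc; first by rewrite /touchpoints /path_of /= muln0.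
have := point_path_of _ _ vc; rewrite /path_of.
(* The path ends with a North step; removing it drops the endpoint, which is not to be counted. *)
have [r rE] : exists r, room v (k :: c) = r.+1 by exists (v + k).-1 => /=; lia.
have := room_le _ _ vc; rewrite rE rcons_nseqS => rc /touchpoints_rcons->.
rewrite count_on_line_cat_nseq point_prefix_of // rE ?count_on_line_prefix_of //.
  by rewrite (_ : (_ + r == _) = false) ?andbF ?addn0 //=; move: rc => /=; lia.
by move: rc => /=; lia.
Qed.

(** * The permutation of a code and its avoidance of 132 *)

Fixpoint av132 (s : seq nat) : bool :=
  if s is x :: s' then
    pairwise (fun y z => ~~ ((x < z) && (z < y))) s' && av132 s'
  else true.

Lemma avoids132P (s : seq nat) :
  reflect (forall i j k, i < j -> j < k -> k < size s ->
             ~~ (nth 0 s i < nth 0 s k < nth 0 s j)) (avoids132 s).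
Proof.
apply: (iffP idP) => [/existsPn av i j k ij jk ks | av].
  have js := ltn_trans jk ks; have is_ := ltn_trans ij js.
  have /existsPn/(_ (Ordinal js))/existsPn/(_ (Ordinal ks)) := av (Ordinal is_).
  by rewrite /= ij jk.
apply/existsPn => i; apply/existsPn => j; apply/existsPn => k.
apply/negP => /and4P[ij jk ik kj].
by have := av i j k ij jk (ltn_ord k); rewrite ik kj.
Qed.

Lemma avoids132E s : avoids132 s = av132 s.
Proof.
elim: s => [|x s IH]; first by apply/avoids132P.
rewrite /= -IH; apply/avoids132P/andP => [av | [/(pairwiseP 0) pw /avoids132P av]].
  split; last by apply/avoids132P => i j k ij jk ks; exact: (av i.+1 j.+1 k.+1).
  by apply/(pairwiseP 0) => j k js ks jk; exact: (av 0 j.+1 k.+1).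
move=> [|i] [|j] [|k] // ij jk ks; last exact: av.
by apply: pw => //; rewrite inE; move: jk ks => /=; lia.
Qed.

Definition widen (m v x : nat) : nat := if x <= m then x else x + v.

(** For a valid code, this [m] leaves exactly [k] entries of the tail above the block
    [m.+1, ..., m + v]; [widen] opens the gap for that block. *)
Fixpoint perm_of (v : nat) (c : seq nat) : seq nat :=
  if c is k :: c' then
    let m := v * size c' - k in iota m.+1 v ++ map (widen m v) (perm_of v c')
  else [::].

Lemma ltn_widen m v : {mono widen m v : x y / x < y}.
Proof. by rewrite /widen => x y; case: (leqP x m); case: (leqP y m); lia. Qed.

Lemma widen_inj m v : injective (widen m v).
Proof. by rewrite /widen => x y; case: (leqP x m); case: (leqP y m); lia. Qed.

Lemma av132_map (f : nat -> nat) s :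
  {in s &, {mono f : x y / x < y}} -> av132 (map f s) = av132 s.
Proof.
elim: s => //= x s IH fm; rewrite IH; last first.
  by move=> y z ys zs; apply: fm; rewrite inE ?ys ?zs orbT.
congr andb; rewrite pairwise_map.
apply: (eq_in_pairwise (P := mem s)) (allss s) => y z ys zs /=.
by rewrite !fm ?inE ?eqxx ?ys ?zs ?orbT.
Qed.

Lemma size_perm_of v c : size (perm_of v c) = v * size c.
Proof.
elim: c => [|k c IH] /=; first by rewrite muln0.
by rewrite size_cat size_map size_iota IH mulnS.
Qed.

Lemma perm_of_perm v c : valid v c -> perm_eq (perm_of v c) (iota 1 (v * size c)).
Proof.
elim: c => [|k c IH] /=; first by rewrite muln0.
case/andP=> kc vc; have rc := room_le _ _ vc; set m := _ - k.
have sz : size (iota m.+1 v ++ map (widen m v) (perm_of v c)) = v * (size c).+1.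
  exact: (size_perm_of v (k :: c)).
have mE := perm_mem (IH vc).
have us : uniq (iota m.+1 v ++ map (widen m v) (perm_of v c)).
  rewrite cat_uniq iota_uniq map_inj_uniq; last exact: widen_inj.
  rewrite (perm_uniq (IH vc)) iota_uniq andbT /=.
  apply/hasPn => y /mapP[x _ ->]; rewrite mem_iota /widen.
  by case: (leqP x m); lia.
apply: uniq_perm => //; first exact: iota_uniq.
have sub : {subset iota m.+1 v ++ map (widen m v) (perm_of v c)
    <= iota 1 (v * (size c).+1)}.
  move=> y; rewrite mem_cat => /orP[|/mapP[x]].
    by rewrite !mem_iota; lia.
  by rewrite mE !mem_iota /widen => xr ->; case: (leqP x m); lia.
by have [] := uniq_min_size us sub; rewrite ?size_iota ?sz.
Qed.

(** Turns [k <= room v c] into the condition that the first entry is at most [m.+1], where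
    [m = v * size c - k]. The default [1] makes the formula hold for the empty code. *)
Lemma head_perm_of v c : 0 < v -> valid v c ->
  head 1 (perm_of v c) = (v * size c).+1 - room v c.
Proof.
case: c => [|k c] v0 /=; first by rewrite muln0.
by case/andP=> kc /room_le rc; case: v v0 kc rc => //= v _; lia.
Qed.

(** Two entries above [m] in decreasing order would form 132 with the first entry, which is at most
    [m.+1] and differs from the later ones. *)
Lemma av132_pairwise_ge m (s : seq nat) : uniq s -> av132 s -> head 1 s <= m.+1 ->
  pairwise (fun y z => ~~ (m < z < y)) s.
Proof.
case: s => //= x s /andP[xs us] /andP[pw _] xm; apply/andP; split.
  by apply/allP => z zs; apply/negP; lia.
apply/(pairwiseP 0) => i j i_s j_s ij; move/(pairwiseP 0): pw => /(_ _ _ i_s j_s ij).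
have : nth 0 s j != x by apply: contraNneq xs => <-; exact: mem_nth.
by lia.
Qed.

(** No 132 starts in the first block: the block increases, no tail entry lies between two of its
    values, and the tail entries above it increase. *)
Lemma av132_perm_of v c : 0 < v -> valid v c -> av132 (perm_of v c).
Proof.
move=> v0; elim: c => //= k c IH /andP[kc vc]; have rc := room_le _ _ vc.
set m := _ - k; set u := perm_of v c.
have top : pairwise (fun y z => ~~ (m < z < y)) u.
  apply: av132_pairwise_ge.
    by rewrite (perm_uniq (perm_of_perm _ _ vc)) iota_uniq.
    exact: IH.
  by rewrite head_perm_of //; lia.
have wide x : m < x <= m + v ->
    pairwise (fun y z => ~~ (x < z < y)) (map (widen m v) u).
  move=> xm; rewrite pairwise_map; apply: sub_pairwise top => y z /=.
  by rewrite /widen; case: (leqP y m); case: (leqP z m); lia.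
have tail : av132 (map (widen m v) u).
  by rewrite av132_map ?IH // => x y _ _; rewrite ltn_widen.
(* The block is generalised to any run of values in the gap, to allow induction on its length. *)
suff block w x : m < x -> x + w <= m.+1 + v ->
  av132 (iota x w ++ map (widen m v) u) by apply: block.
elim: w x => [|w IHw] x //= xm xv; rewrite {}IHw; try lia.
rewrite andbT pairwise_cat wide; last lia.
rewrite andbT; apply/andP; split.
  apply/allrelP => y z; rewrite mem_iota => yr /mapP[t _ ->].
  by rewrite /widen; case: (leqP t m); lia.
apply: (sub_pairwise _ (r := ltn)) => [y z /=|]; first lia.
by rewrite -sorted_pairwise ?iota_ltn_sorted //; exact: ltn_trans.
Qed.

(** * Codes correspond to 132-avoiding permutations with increasing blocks *)

Definition block_increasing (v : nat) (s : seq nat) : Prop :=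
  forall i, i.+1 < size s -> ~~ (v %| i.+1) -> nth 0 s i < nth 0 s i.+1.

Lemma block_increasing_perm_of v c : block_increasing v (perm_of v c).
Proof.
elim: c => //= k c IH i; set m := _ - k; rewrite size_cat size_iota size_map.
move=> ilt nd; rewrite !nth_cat size_iota.
have [iv|iv] := ltnP i.+1 v; first by rewrite (ltnW iv) !nth_iota ?(ltnW iv) //; lia.
have {}iv : v <= i by rewrite -ltnS ltn_neqAle iv andbT; apply: contraNneq nd => ->.
rewrite (_ : i < v = false) ?(_ : i.+1 < v = false) ?subSn //; try lia.
rewrite !(nth_map 0) ?ltn_widen; try lia.
apply: IH; first lia.
by apply: contra nd => dv; rewrite -(subnK iv) -addSn dvdn_add.
Qed.

(** For a given length the first entry determines [k]; dropping the block and undoing [widen] leaves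
    the permutation of the rest. *)
Lemma perm_of_inj v c c' : 0 < v -> valid v c -> valid v c' -> size c = size c' ->
  perm_of v c = perm_of v c' -> c = c'.
Proof.
move=> v0; elim: c c' => [|k c IH] [|k' c'] // vc vc' szE pE.
have hE : head 1 (perm_of v (k :: c)) = head 1 (perm_of v (k' :: c')) by rewrite pE.
have {hE} kE : k = k'.
  move: hE; rewrite !head_perm_of // szE.
  by have := room_le _ _ vc; have := room_le _ _ vc'; rewrite szE /=; lia.
case: szE (andP vc) (andP vc') => szE [_ {}vc] [_ {}vc'].
move: pE; rewrite /= -kE -szE => /(congr1 (drop v)).
rewrite !drop_size_cat ?size_iota // => /(inj_map (widen_inj _ _)) pE.
by rewrite (IH c').
Qed.

Lemma av132_catr b t : av132 (b ++ t) -> av132 t.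
Proof. by elim: b => //= x b IH /andP[_]. Qed.

(* The entries above m increase, hence are m.+1, ..., N in this order. *)
Lemma av132_filter_gt N m s : perm_eq s (iota 1 N) -> av132 s ->
  head 1 s <= m.+1 -> [seq y <- s | m < y] = iota m.+1 (N - m).
Proof.
move=> sp avs hs; have us : uniq s by rewrite (perm_uniq sp) iota_uniq.
have pw := av132_pairwise_ge m s us avs hs.
apply: (irr_sorted_eq ltn_trans ltnn); last 1 first.
- by move=> y; rewrite mem_filter (perm_mem sp) !mem_iota; lia.
- rewrite (sorted_pairwise ltn_trans).
  have : pairwise [rel y z | ~~ (m < z < y) && (y != z)] [seq y <- s | m < y].
    by rewrite pairwise_relI !pairwise_filter // -uniq_pairwise.
  apply: (sub_in_pairwise (P := ltn m)); last exact: filter_all.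
  by move=> y z; rewrite !inE /=; lia.
- exact: iota_ltn_sorted.
Qed.

Lemma perm_of_surj v d s : 0 < v -> perm_eq s (iota 1 (v * d)) -> av132 s ->
  block_increasing v s ->
  exists c, [/\ valid v c, size c = d & perm_of v c = s].
Proof.
move=> v0; elim: d s => [|d IH] s sp avs incs.
  by exists [::]; split=> //; move: sp; rewrite muln0 => /perm_nilP ->.
have szs : size s = v * d.+1 by rewrite (perm_size sp) size_iota.
have mems y : y \in s = (0 < y <= v * d.+1) by rewrite (perm_mem sp) mem_iota; lia.
have us : uniq s by rewrite (perm_uniq sp) iota_uniq.
have h0 : 0 < head 1 s <= v * d.+1.
  by rewrite -mems -nth0 mem_nth // szs muln_gt0 v0.
have [m hm] : exists m, head 1 s = m.+1 by exists (head 1 s).-1; lia.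
have fs := av132_filter_gt _ m _ sp avs (eq_leq hm).
have sE := esym (cat_take_drop v s).
set b := take v s in sE; set t := drop v s in sE.
have szb : size b = v by rewrite size_take_min szs; lia.
have sb : sorted ltn b.
  apply/(sortedP 0) => i; rewrite szb => iv.
  rewrite !nth_take //; last exact: ltnW.
  by apply: incs; rewrite ?gtnNdvd // szs mulnS ltn_addr.
have hb : head 1 b = m.+1 by rewrite -hm sE; case: b szb {sE sb} => //=; lia.
(* The block increases from [m.+1], so it is made of the first [v] entries above [m], and these are
   consecutive. *)
have bE : b = iota m.+1 v.
  have allb : all (ltn m) b.
    case: b hb sb {szb sE} => //= x b -> /(order_path_min ltn_trans)/allP xb.
    by rewrite ltnSn; apply/allP => y /xb /=; lia.
  move: fs; rewrite sE filter_cat (all_filterP allb) => /(congr1 (take v)).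
  rewrite -{1}szb take_size_cat // take_iota => bE.
  by move: szb; rewrite bE size_iota => ->.
have memt y : y \in t = (0 < y <= v * d.+1) && ~~ (m < y <= m + v).
  have := mems y; rewrite sE mem_cat bE mem_iota => <-.
  have := us; rewrite sE bE cat_uniq => /and3P[_ /hasPn/(_ y) tb _].
  by move: tb; rewrite mem_iota /=; case: (y \in t) => [/(_ isT)|_]; lia.
have md : m <= v * d.
  have := mems (m + v); rewrite sE mem_cat bE mem_iota.
  by rewrite (_ : m.+1 <= _ < _); lia.
pose unwiden y := if y <= m then y else y - v.
pose u := map unwiden t.
have tE : t = map (widen m v) u.
  rewrite -map_comp -[LHS]map_id; apply/eq_in_map => y.
  rewrite memt /= /unwiden /widen; case: (leqP y m) => ym; first by rewrite ym.
  by case: (leqP (y - v) m); lia.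
have ut : uniq t by rewrite drop_uniq.
have szt : size t = v * d by rewrite size_drop szs; lia.
have uu : uniq u by move: ut; rewrite tE map_inj_uniq //; exact: widen_inj.
have up : perm_eq u (iota 1 (v * d)).
  apply: uniq_perm => //; first exact: iota_uniq.
  have sub : {subset u <= iota 1 (v * d)}.
    move=> _ /mapP[y + ->]; rewrite memt mem_iota /unwiden.
    by case: (leqP y m); lia.
  by have [] := uniq_min_size uu sub; rewrite ?size_iota ?size_map ?szt.
have avt : av132 t by apply: (av132_catr b); rewrite -sE.
have avu : av132 u.
  by move: avt; rewrite tE av132_map // => x y _ _; rewrite ltn_widen.
have incu : block_increasing v u.
  move=> i; rewrite size_map => ilt nd; rewrite -(ltn_widen m v).
  rewrite -!(nth_map 0 0 (widen m v)) ?size_map //; last exact: ltnW.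
  rewrite -tE !nth_drop addnS; apply: incs.
    by move: ilt; rewrite szt szs mulnS -addnS ltn_add2l.
  by apply: contra nd; rewrite -addnS dvdn_addr.
have [c [vc szc uE]] := IH u up avu incu.
(* The new letter counts the entries of [u] above [m]. *)
exists (v * d - m :: c); split=> /=; last 2 first.
- by rewrite szc.
- by rewrite szc subKn // uE -tE -bE -sE.
(* If the letter exceeded [room v c], then [u] would start above [m.+1] and contain [m.+1] later.
   After widening, these two entries and the first entry [m.+1] of [s] would form 132. *)
rewrite vc andbT leqNgt; apply/negP => kc.
have hu : head 1 u = (v * d).+1 - room v c by rewrite -uE head_perm_of // szc.
have mu : m.+1 \in u by rewrite (perm_mem up) mem_iota; lia.
have {avs} : pairwise (fun y z => ~~ (m.+1 < z < y)) t.
  have bcons : b = m.+1 :: behead b.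
    by move: hb szb; case: (b) => [|y b'] /= yE //; [lia | rewrite yE].
  by move: avs; rewrite sE bcons /= pairwise_cat => /andP[/and3P[]].
rewrite tE; case: u hu mu {uu up tE avu incu uE} => //= x u xE.
rewrite inE => /orP[/eqP|mu]; first by lia.
case/andP=> /allP/(_ (widen m v m.+1)); rewrite map_f // => /(_ isT).
rewrite ltn_widen {1}/widen ltnn => /negP; lia.
Qed.

(** * Descents, right-to-left maxima and increasing subsequences of the permutation *)

Lemma nadj_map {T U : Type} (f : T -> U) (r : rel T) (r' : rel U) s :
  (forall x y, r' (f x) (f y) = r x y) -> nadj r' (map f s) = nadj r s.
Proof. by move=> rr; elim: s => //= x [|y s] //= ->; rewrite rr. Qed.

(** Only the last entry [x + w] of the run can start a descent; as the default of [head], it gives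
    none when [t] is empty. *)
Lemma nadj_iota_cat x w t :
  nadj gtn (iota x w.+1 ++ t) = (head (x + w) t < x + w) + nadj gtn t.
Proof.
elim: w x => [|w IH] x; first by case: t => [|y t] /=; rewrite ?addn0 ?ltnn.
rewrite -[LHS]/((x.+1 < x : nat) + nadj gtn (iota x.+1 w.+1 ++ t)) IH.
by rewrite addSnnS ltnNge leqnSn.
Qed.

Lemma des_perm_of v c : 0 < v -> valid v c -> des (perm_of v c) = ndrops v c.
Proof.
move=> v0; rewrite /des (card_adj gtn); elim: c => //= k c IH /andP[kc vc].
have rc := room_le _ _ vc; set m := _ - k.
have -> : iota m.+1 v = iota m.+1 v.-1.+1 by rewrite prednK.
rewrite nadj_iota_cat (nadj_map (widen m v) gtn); last first.
  by move=> x y; rewrite /= ltn_widen.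
(* The end of the block is a descent exactly when the first entry of the tail is at most [m], that
   is, when [k < room v c]. *)
rewrite IH //; congr addn; congr nat_of_bool.
have := head_perm_of _ _ v0 vc; have := size_perm_of v c.
case: (perm_of v c) => [|x s] /= sE hE; first by apply/idP/idP; lia.
by rewrite /widen; apply/idP/idP; case: (leqP x m); lia.
Qed.

Fixpoint nrlmax (s : seq nat) : nat :=
  if s is x :: s' then all (gtn x) s' + nrlmax s' else 0.

Lemma rlmaxE s : rlmax s = nrlmax s.
Proof.
rewrite /rlmax; elim: s => [|x s IH].
  by apply/eqP; rewrite cards_eq0; apply/eqP/setP => -[].
rewrite /= -IH !cardsE -!sum1_card big_mkcond big_ord_recl.
rewrite [X in _ = _ + X]big_mkcond /=; congr addn.
  rewrite unfold_in /=.
  set b := (X in if X then _ else _); suff -> : b = all (gtn x) s by case: all.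
  apply/forallP/(all_nthP 0) => [H i i_s | H [[|j] js] //=]; last exact: H.
  by have := H (lift ord0 (Ordinal i_s)).
apply: eq_bigr => i _; rewrite !unfold_in /=; congr (if _ then _ else _).
apply/forallP/forallP => H j; first by have := H (lift ord0 j).
by case: (unliftP ord0 j) => [j' ->|-> //]; have := H j'.
Qed.

Lemma nrlmax_iota_cat x w t :
  nrlmax (iota x w.+1 ++ t) = all (gtn (x + w)) t + nrlmax t.
Proof.
elim: w x => [|w IH] x; first by rewrite /= addn0.
rewrite -[LHS]/(all (gtn x) (iota x.+1 w.+1 ++ t) + nrlmax (iota x.+1 w.+1 ++ t)) IH.
by rewrite addSnnS /= ltnNge leqnSn.
Qed.

Lemma nrlmax_map f s : {mono f : x y / x < y} -> nrlmax (map f s) = nrlmax s.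
Proof.
move=> fm; elim: s => //= x s ->; rewrite all_map; congr (nat_of_bool _ + _).
by apply: eq_all => y /=; rewrite fm.
Qed.

Lemma rlmax_perm_of v c : 0 < v -> valid v c ->
  rlmax (perm_of v c) = count_mem 0 c.
Proof.
move=> v0; rewrite rlmaxE; elim: c => //= k c IH /andP[kc vc].
have rc := room_le _ _ vc; set m := _ - k.
have -> : iota m.+1 v = iota m.+1 v.-1.+1 by rewrite prednK.
rewrite nrlmax_iota_cat nrlmax_map ?IH //; last exact: ltn_widen.
congr (nat_of_bool _ + _).
rewrite all_map (perm_all _ (perm_of_perm _ _ vc)).
apply/allP/eqP => [H | k0 x]; last first.
  by rewrite mem_iota /= /widen; case: (leqP x m); lia.
(* If [k] is positive, the largest entry of the tail is widened past [m + v]. *)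
have [//|k_gt0] := posnP k; have := H (v * size c).
by rewrite mem_iota /= /widen; case: (leqP (v * size c) m); lia.
Qed.

Lemma lis_ge r s : subseq r s -> sorted ltn r -> size r <= lis s.
Proof.
case/subseqP=> m /eqP szm -> sm.
exact: (@leq_bigmax_cond _ (fun m : (size s).-tuple bool => sorted ltn (mask m s))
  (fun m : (size s).-tuple bool => size (mask m s)) (Tuple szm)).
Qed.

Lemma lis_le n s :
  (forall r, subseq r s -> sorted ltn r -> size r <= n) -> lis s <= n.
Proof. by move=> H; apply/bigmax_leqP => m sm; apply: H => //; exact: mask_subseq. Qed.

(** The entries above [m] form an increasing subsequence of length [v + k]. Any increasing
    subsequence either stays above [m] or misses the first block and lies in the tail. *)
Lemma lis_perm_of_cons v k c : 0 < v -> valid v (k :: c) ->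
  lis (perm_of v (k :: c)) = maxn (v + k) (lis (perm_of v c)).
Proof.
move=> v0 vkc; have [kc vc] := andP vkc; have rc := room_le _ _ vc.
have sp := perm_of_perm _ _ vkc; have avs := av132_perm_of _ _ v0 vkc.
pose m := v * size c - k.
have fs : [seq y <- perm_of v (k :: c) | m < y] = iota m.+1 (v + k).
  rewrite (av132_filter_gt _ _ _ sp avs) ?head_perm_of //; last by rewrite /= /m; lia.
  by congr iota; rewrite /= /m; lia.
apply/eqP; rewrite eqn_leq geq_max; apply/and3P; split; last first.
- apply: lis_le => r ru sr; rewrite -(size_map (widen m v)); apply: lis_ge.
    exact: subseq_trans (map_subseq _ ru) (suffix_subseq _ _).
  by rewrite sorted_map; apply: sub_sorted sr => x y /=; rewrite ltn_widen.
- rewrite -{1}(size_iota m.+1 (v + k)) -fs; apply: lis_ge; first exact: filter_subseq.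
  by rewrite fs iota_ltn_sorted.
apply: lis_le => r rs sr; rewrite leq_max.
have [allr|] := boolP (all (ltn m) r).
  apply/orP; left; rewrite -(size_iota m.+1 (v + k)) -fs.
  apply: uniq_leq_size.
    by apply: subseq_uniq rs _; rewrite (perm_uniq sp) iota_uniq.
  by move=> y yr; rewrite mem_filter (mem_subseq rs yr) andbT; exact: (allP allr).
move=> nallr; apply/orP; right.
case/subseqP: rs => bs szbs rE.
move: rE; rewrite /= -/m -(cat_take_drop v bs) mask_cat; last first.
  by rewrite size_take_min szbs size_perm_of size_iota /=; lia.
set r1 := mask _ _; set r2 := mask _ _ => rE.
have r1s : {subset r1 <= iota m.+1 v} by move=> y; exact: mem_mask.
(* An entry taken from the block would come first and force all of [r] above [m]. *)
have r10 : r1 = [::].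
  case: r1 r1s rE => // x r1 /(_ x); rewrite inE eqxx mem_iota => /(_ isT) xm rE.
  case/negP: nallr; move: sr; rewrite rE /= => /(order_path_min ltn_trans)/allP xr.
  by apply/andP; split; [lia | apply/allP => y /xr /=; lia].
move: rE sr; rewrite r10 cat0s /r2 -map_mask => -> sr; rewrite size_map.
apply: lis_ge; first exact: mask_subseq.
by move: sr; rewrite sorted_map; apply: sub_sorted => x y /=; rewrite ltn_widen.
Qed.

Lemma lis_perm_of v c : 0 < v -> valid v c ->
  lis (perm_of v c) = \max_(k <- c) (v + k).
Proof.
move=> v0; elim: c => [|k c IH] vc.
  rewrite big_nil; apply/eqP; rewrite -leqn0; apply: lis_le => r.
  by rewrite subseq0 => /eqP ->.
by rewrite lis_perm_of_cons // big_cons IH //; case/andP: vc.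
Qed.

(** * Labelled diamonds as words with increasing blocks *)

Lemma nth_allpairs {S T U : Type} (f : S -> T -> U) x0 y0 z0 s t i j :
  i < size s -> j < size t ->
  nth z0 [seq f x y | x <- s, y <- t] (i * size t + j) = f (nth x0 s i) (nth y0 t j).
Proof.
elim: s i => //= x s IH [|i] i_s jt; rewrite nth_cat size_map.
  by rewrite jt (nth_map y0).
rewrite mulSn -addnA ltnNge leq_addr /= addKn; exact: IH.
Qed.

Lemma nth_diamond_perm v d (D : labelling v d) (i : 'I_d) (a : 'I_v) :
  nth 0 (diamond_perm D) (i * v + a) = label D i a.
Proof.
have := nth_allpairs (label D) i a 0 (enum 'I_d) (enum 'I_v) i a.
by rewrite !size_enum_ord !nth_ord_enum => ->.
Qed.

Lemma size_diamond_perm v d (D : labelling v d) : size (diamond_perm D) = v * d.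
Proof. by rewrite size_allpairs !size_enum_ord mulnC. Qed.

Lemma diamond_perm_inj v d : injective (@diamond_perm v d).
Proof.
move=> D D' DE; apply/ffunP => -[i a]; apply/val_inj/succn_inj.
by rewrite -/(label D i a) -/(label D' i a) -!nth_diamond_perm DE.
Qed.

Lemma position_lt v d i a : i < d -> a < v -> i * v + a < v * d.
Proof. by nia. Qed.

Lemma block_increasing_diamonds132 v d (D : labelling v d) : 0 < v ->
  D \in diamonds132 v d -> block_increasing v (diamond_perm D).
Proof.
move=> v0; rewrite inE => /andP[DD /avoids132P av] n.
have szD := size_diamond_perm v d D; rewrite szD => nlt nd.
have := perm_diamond_perm DD => /perm_uniq; rewrite iota_uniq => uD.
have av_lt : (n %% v).+1 < v.
  rewrite ltn_neqAle ltn_pmod // andbT; apply: contraNneq nd => nE.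
  by rewrite (divn_eq n v) -addnS nE dvdn_addl // dvdn_mull.
have id : n %/ v < d by rewrite ltn_divLR // mulnC; apply: ltnW.
pose i := Ordinal id; pose a := Ordinal (ltnW av_lt); pose a' := Ordinal av_lt.
pose o := Ordinal v0.
have nE : nth 0 (diamond_perm D) n = label D i a.
  by rewrite -nth_diamond_perm /= -divn_eq.
have nE' : nth 0 (diamond_perm D) n.+1 = label D i a'.
  by rewrite -nth_diamond_perm /= addnS -divn_eq.
have {}DD : forall b c, diamond_lt b c -> label D i b < label D i c.
  move: DD; rewrite inE => /andP[_ /forallP/(_ i)/forallP H] b c bc.
  by have /forallP/(_ c)/implyP := H b; exact.
have [a0|a_gt0] := posnP (n %% v).
  by rewrite nE nE'; apply: DD; rewrite /diamond_lt /= a0.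
have oE : nth 0 (diamond_perm D) (n %/ v * v) = label D i o.
  by rewrite -nth_diamond_perm /= addn0.
have [a_max|a_max] := eqVneq (n %% v).+1 v.-1.
  by rewrite nE nE'; apply: DD; rewrite /diamond_lt /= ltnSn a_max eqxx orbT.
(* Both vertices are now middle ones; a descent between them would form 132 with the least label of
   the diamond. *)
have lt_on : n %/ v * v < n by rewrite {2}(divn_eq n v) -addn1 leq_add2l.
have := av _ n n.+1 lt_on (ltnSn n); rewrite szD => /(_ nlt).
have o_lt : nth 0 (diamond_perm D) (n %/ v * v) < nth 0 (diamond_perm D) n.+1.
  by rewrite oE nE'; apply: DD; rewrite /diamond_lt.
have : nth 0 (diamond_perm D) n != nth 0 (diamond_perm D) n.+1.
  by rewrite nth_uniq ?szD ?(ltnW nlt) //; lia.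
by rewrite o_lt /=; lia.
Qed.

Lemma block_increasing_lt v s i a b : block_increasing v s ->
  i * v + b < size s -> b < v -> a < b -> nth 0 s (i * v + a) < nth 0 s (i * v + b).
Proof.
move=> incs; elim: b => // b IH bs bv; rewrite ltnS leq_eqVlt.
have step : nth 0 s (i * v + b) < nth 0 s (i * v + b.+1).
  rewrite addnS; apply: incs; rewrite -addnS //.
  by rewrite dvdn_addr ?dvdn_mull // gtnNdvd.
by case/orP=> [/eqP -> //|ab]; apply: ltn_trans step; apply: IH => //; lia.
Qed.

Lemma diamonds132_perm v d (s : seq nat) : 0 < v -> 0 < d ->
  perm_eq s (iota 1 (v * d)) -> av132 s -> block_increasing v s ->
  exists2 D, D \in diamonds132 v d & diamond_perm D = s.
Proof.
move=> v0 d0 sp avs incs; have vd0 : 0 < v * d by rewrite muln_gt0 v0.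
have szs : size s = v * d by rewrite (perm_size sp) size_iota.
have us : uniq s by rewrite (perm_uniq sp) iota_uniq.
(* The predecessor undoes the shift in [label]; the entries lie in [1, ..., v * d], so the default
   of [insubd] is never taken. *)
pose D : labelling v d :=
  [ffun ia : 'I_d * 'I_v => insubd (Ordinal vd0) (nth 0 s (ia.1 * v + ia.2)).-1].
have lE i a : label D i a = nth 0 s (i * v + a).
  have ia : i * v + a < v * d by apply: position_lt.
  have : nth 0 s (i * v + a) \in s by rewrite mem_nth ?szs.
  rewrite (perm_mem sp) mem_iota /label ffunE /= => /andP[n0 nlt].
  by rewrite val_insubd prednK // -ltnS nlt prednK.
have sE : diamond_perm D = s.
  apply: (@eq_from_nth _ 0); rewrite size_diamond_perm ?szs // => n nlt.
  have id : n %/ v < d by rewrite ltn_divLR // mulnC.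
  rewrite (divn_eq n v).
  exact: (etrans (nth_diamond_perm v d D (Ordinal id) (Ordinal (ltn_pmod n v0)))
           (lE _ _)).
exists D => //; rewrite inE avoids132E sE avs andbT inE; apply/andP; split.
  apply/injectiveP => -[i a] [j b] DE.
  have : label D i a == label D j b by rewrite /label DE.
  rewrite !lE nth_uniq ?szs ?position_lt // => /eqP E.
  have aE : a = b :> nat.
    by have := congr1 (modn^~ v) E; rewrite /= !modnMDl !modn_small.
  have iE : i = j :> nat by apply/eqP; rewrite -(eqn_pmul2r v0) -(eqn_add2r a) {2}aE E.
  by congr pair; apply: val_inj.
apply/forallP => i; apply/forallP => a; apply/forallP => b; apply/implyP.
by rewrite !lE => /andP[ab _]; apply: block_increasing_lt; rewrite ?szs ?position_lt.
Qed.

(** * Comparison of the two generating functions *)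

(** Both sides consist of the words [perm_of v c] for the valid codes [c] of length [d]. *)
Lemma mem_diamond_perms v d s : 0 < v -> 0 < d ->
  (s \in [seq diamond_perm D | D in diamonds132 v d]) =
  (s \in [seq perm_of v (code_of v p) | p : (d + v * d).-tuple bool in Dyck v d]).
Proof.
move=> v0 d0; apply/imageP/imageP => -[].
  move=> D DD ->.
  have := DD; rewrite inE => /andP[D1 D2].
  have [c [vc szc <-]] := perm_of_surj v d (diamond_perm D) v0
    (perm_diamond_perm D1) (etrans (esym (avoids132E _)) D2)
    (block_increasing_diamonds132 v d D v0 DD).
  have pE := point_path_of v c vc; rewrite szc in pE.
  have szp : size (path_of v c) == d + v * d by rewrite size_point pE.
  exists (Tuple szp); last by rewrite /= code_of_path_of.
  by rewrite DyckP below_path_of //= pE.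
move=> p; rewrite DyckP => /andP[bp /eqP pE] ->.
have [vc szc _] := path_of_code_of v d p bp pE.
have [] := diamonds132_perm v d (perm_of v (code_of v p)) v0 d0.
- by have := perm_of_perm v _ vc; rewrite szc.
- exact: av132_perm_of.
- exact: block_increasing_perm_of.
by move=> D DD DE; exists D.
Qed.

Local Open Scope ring_scope.

Theorem theorem2p5 (v d : nat) (hv : (4 <= v)%N) (hd : (1 <= d)%N) :
  \sum_(D in diamonds132 v d)
     var_w ^+ rlmax (diamond_perm D) * var_x ^+ des (diamond_perm D)
       * var_y ^+ d * var_z ^+ lis (diamond_perm D)
  = \sum_(p in Dyck v d)
     var_w ^+ touchpoints v d p * var_x ^+ corners p
       * var_y ^+ d * var_z ^+ height v p.
Proof.
have v0 : (0 < v)%N by apply: leq_trans hv.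
(* The summand depends on [D] only through its word, so the sum runs over words and can be reindexed
   by Dyck paths. *)
pose F s := var_w ^+ rlmax s * var_x ^+ des s * var_y ^+ d * var_z ^+ lis s.
rewrite -(big_image _ _ _ _ F) /=.
have pE : perm_eq [seq diamond_perm D | D in diamonds132 v d]
    [seq perm_of v (code_of v p) | p : (d + v * d).-tuple bool in Dyck v d].
  apply: uniq_perm => [||s]; last exact: mem_diamond_perms.
    by rewrite map_inj_uniq ?enum_uniq //; exact: diamond_perm_inj.
  rewrite map_inj_in_uniq ?enum_uniq // => p q; rewrite !mem_enum !DyckP.
  move=> /andP[bp /eqP pE] /andP[bq /eqP qE].
  have [vp szp pP] := path_of_code_of v d p bp pE.
  have [vq szq qQ] := path_of_code_of v d q bq qE.
  move=> /perm_of_inj cE; apply: val_inj.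
  by rewrite /= -pP -qQ cE // szp szq.
rewrite (perm_big _ pE) big_image /=; apply: eq_bigr => p.
rewrite DyckP => /andP[bp /eqP pdE].
have [vp szp pP] := path_of_code_of v d p bp pdE.
rewrite /F rlmax_perm_of // des_perm_of // lis_perm_of //.
rewrite -(touchpoints_path_of v) // -corners_path_of -height_path_of //.
by rewrite szp pP.
Qed.
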